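(* Let $\chi,\chi'$ be characters of $Z_\kappa$, $J\subset S_{\mathrm{aff},\chi}$, $J'\subset S_{\mathrm{aff},\chi'}$, and put $\Xi=\Xi_{J,\chi}$, $\Xi'=\Xi_{J',\chi'}$. Let $V$ (resp. $V'$) be a simple $C[\Omega(1)_\Xi]$-module (resp. $C[\Omega(1)_{\Xi'}]$-module) whose restriction to $Z_\kappa$ is a direct sum of copies of $\chi$ (resp. $\chi'$). Put $\Omega_{\Xi,\Xi'}=\Omega_\Xi\cap\Omega_{\Xi'}$ and $\mathcal{H}_{\Xi,\Xi'}=\mathcal{H}_\Xi\cap\mathcal{H}_{\Xi'}$. Then the restriction map \[ \mathrm{Ext}^1_{\mathcal{H}_{\Xi,\Xi'}}(\Xi\otimes V,\Xi'\otimes V')\to\mathrm{Ext}^1_{\mathcal{H}^{\mathrm{aff}}}(\Xi\otimes V,\Xi'\otimes V')^{\Omega_{\Xi,\Xi'}} \] is surjective.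
   Context: $C$ is an algebraically closed field of characteristic $p$; modules are right modules. Data: a Coxeter system $(W_{\mathrm{aff}},S_{\mathrm{aff}})$ with length function $\ell$; a commutative group $\Omega$ acting on $(W_{\mathrm{aff}},S_{\mathrm{aff}})$; $W=W_{\mathrm{aff}}\rtimes\Omega$; a finite commutative group $Z_\kappa$ of order prime to $p$; an extension $1\to Z_\kappa\to W(1)\to W\to1$. $\ell$ is extended to $W$ and $W(1)$, trivially on $\Omega$. $W(1)$ acts by conjugation on $Z_\kappa$ and $C[Z_\kappa]$, written $w\cdot c$. $\mathrm{Ref}(W_{\mathrm{aff}}(1))\subset W(1)$ is the preimage of the set of reflections of $W_{\mathrm{aff}}$. A parameter $c:\mathrm{Ref}(W_{\mathrm{aff}}(1))\to C[Z_\kappa]$, $s\mapsto c_s$, is given with $c_{wsw^{-1}}=w\cdot c_s$ ($w\in W(1)$) and $c_{ts}=tc_s$ ($t\in Z_\kappa$); the parameters $q_s$ are all $0$. The data need not come from a reductive group. $\mathcal{H}$ is the $C$-algebra with basis $T_w$ ($w\in W(1)$) and relations $T_{vw}=T_vT_w$ if $\ell(vw)=\ell(v)+\ell(w)$, $T_s^2=c_sT_s$ for $s\in W(1)$ lifting an element of $S_{\mathrm{aff}}$ ($C[Z_\kappa]\subset\mathcal{H}$ via $t\mapsto T_t$). $W^{\mathrm{aff}}(1)$ is the preimage of $W_{\mathrm{aff}}$ in $W(1)$, $\mathcal{H}^{\mathrm{aff}}=\bigoplus_{w\in W^{\mathrm{aff}}(1)}CT_w$; $\Omega(1)$ is the preimage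 of $\Omega$, and $C[\Omega(1)]\subset\mathcal{H}$ via $\omega\mapsto T_\omega$. For a character $\chi$ of $Z_\kappa$ (extended to $C[Z_\kappa]$), $S_{\mathrm{aff},\chi}=\{s\in S_{\mathrm{aff}}\mid\chi(c_{\tilde s})\ne0\}$ with $\tilde s\in W(1)$ any lift of $s$. For $J\subset S_{\mathrm{aff},\chi}$, $\Xi_{J,\chi}$ is the character of $\mathcal{H}^{\mathrm{aff}}$ with $T_t\mapsto\chi(t)$ ($t\in Z_\kappa$), and $T_{\tilde s}\mapsto\chi(c_{\tilde s})$ if $s\notin J$, $T_{\tilde s}\mapsto0$ if $s\in J$. For $\omega\in\Omega(1)$ and a character $\Xi$ of $\mathcal{H}^{\mathrm{aff}}$, $(\Xi\omega)(T_w)=\Xi(T_{\omega w\omega^{-1}})$; this depends only on the image of $\omega$ in $\Omega$. $\Omega(1)_\Xi$ and $\Omega_\Xi$ are the stabilizers of $\Xi$ in $\Omega(1)$ and $\Omega$, and $\mathcal{H}_\Xi=\mathcal{H}^{\mathrm{aff}}C[\Omega(1)_\Xi]\subset\mathcal{H}$. $\mathcal{H}_\Xi$ acts on $\Xi\otimes V$ by $(x\otimes y)XY=xX\otimes yY$ for $X\in\mathcal{H}^{\mathrm{aff}}$, $Y\in C[\Omega(1)_\Xi]$. The preimage of $\Omega_{\Xi,\Xi'}$ in $\Omega(1)$ acts on $\mathrm{Hom}_{\mathcal{H}^{\mathrm{aff}}}(M_1,M_2)$, for $\mathcal{H}_{\Xi,\Xi'}$-modules $M_1,M_2$, by $(f\omega)(m)=f(m\omega^{-1})\omega$;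 this factors through $\Omega_{\Xi,\Xi'}$ and induces the action on $\mathrm{Ext}^j_{\mathcal{H}^{\mathrm{aff}}}(M_1,M_2)$. *)

(* Defs.v *)
From HB Require Import structures.
From mathcomp Require Import all_boot all_order all_fingroup all_algebra.
From mathcomp Require Import boolp classical_sets functions.

Set Implicit Arguments.
Unset Strict Implicit.
Unset Printing Implicit Defensive.

Import GRing.Theory.
Local Open Scope classical_set_scope.
Local Open Scope ring_scope.

(** * Coxeter systems and semidirect products *)

Section Coxeter.
Variables (W : groupType) (S : set W).

Definition is_word (l : seq W) (w : W) : Prop :=
  (forall s, s \in l -> S s) /\ w = (\prod_(s <- l) s)%g.

(** [W] is presented by the involutions in [S] and the relations
    [(s t)^m = 1], [m] the order of [s t]: the universal property below tests
    every exponent [n] with [(s t)^n = 1], that is, every multiple of [m], and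
    there is no relation when [s t] has infinite order.  [S] may be
    infinite. *)
Record coxeter_system : Prop := CoxeterSystem {
  cox_invol : forall s, S s -> s <> 1%g /\ (s * s = 1)%g;
  cox_gen : forall w, exists l, is_word l w;
  cox_univ : forall (G : groupType) (f : W -> G),
    (forall s t n, S s -> S t -> ((s * t) ^+ n = 1)%g ->
       ((f s * f t) ^+ n = 1)%g) ->
    exists phi : {multiplicative W -> G}, forall s, S s -> phi s = f s }.

Definition has_word_of_size (w : W) (n : nat) : bool :=
  `[< exists2 l, is_word l w & size l = n >].

Lemma has_word (cS : coxeter_system) (w : W) : exists n, has_word_of_size w n.
Proof.
by have [l lw] := cox_gen cS w; exists (size l); apply/asboolP; exists l.
Qed.

Definition cox_length (cS : coxeter_system) (w : W) : nat :=
  ex_minn (has_word cS w).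

Definition reflection (w : W) : Prop :=
  exists x s, S s /\ w = (x * s * x^-1)%g.

Variable Om : groupType.

Record coxeter_action := CoxeterAction {
  cact :> Om -> W -> W;
  cact1 : forall w, cact 1%g w = w;
  cactA : forall a b w, cact (a * b)%g w = cact a (cact b w);
  cactM : forall a v w, cact a (v * w)%g = (cact a v * cact a w)%g;
  cactS : forall a s, S s -> S (cact a s) }.

Definition sdprod (act : coxeter_action) : Type := (W * Om)%type.

Variable act : coxeter_action.

HB.instance Definition _ := Choice.on (sdprod act).

Definition sd_mul (x y : sdprod act) : sdprod act :=
  (x.1 * act x.2 y.1, x.2 * y.2)%g.
Definition sd_one : sdprod act := (1, 1)%g.
Definition sd_inv (x : sdprod act) : sdprod act :=
  (act x.2^-1 x.1^-1, x.2^-1)%g.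

Lemma cact_1 a : act a 1%g = 1%g.
Proof. by apply: (mulgI (act a 1%g)); rewrite -cactM !mulg1. Qed.

Lemma sd_mulA : associative sd_mul.
Proof. by move=> x y z; rewrite /sd_mul /= cactM cactA !mulgA. Qed.

Lemma sd_mul1 : left_id sd_one sd_mul.
Proof. by case=> a b; rewrite /sd_mul /= cact1 !mul1g. Qed.

Lemma sd_mul1r : right_id sd_one sd_mul.
Proof. by case=> a b; rewrite /sd_mul /= cact_1 !mulg1. Qed.

Lemma sd_mulV : left_inverse sd_one sd_inv sd_mul.
Proof. by case=> a b; rewrite /sd_mul /= -cactM !mulVg cact_1. Qed.

Lemma sd_mulrV : right_inverse sd_one sd_inv sd_mul.
Proof. by case=> a b; rewrite /sd_mul /= -cactA !mulgV cact1 mulgV. Qed.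

HB.instance Definition _ :=
  isGroup.Build (sdprod act) sd_mulA sd_mul1 sd_mul1r sd_mulV sd_mulrV.

Lemma cox_length_act (cS : coxeter_system) a w :
  cox_length cS (act a w) = cox_length cS w.
Proof.
have le b v : (cox_length cS (act b v) <= cox_length cS v)%N.
  rewrite /cox_length; case: (ex_minnP (has_word cS v)) => n.
  move=> /asboolP[l [lS ->] <-] _.
  case: ex_minnP => m _; apply; apply/asboolP.
  exists (map (act b) l); last by rewrite size_map.
  split; first by move=> _ /mapP[s /lS Ss ->]; exact: cactS.
  elim: l {lS} => [|s l IH]; first by rewrite /= !big_nil cact_1.
  by rewrite /= !big_cons cactM IH.
apply/eqP; rewrite eqn_leq le /=.
by rewrite -{1}[w](cact1 act) -(mulVg a) cactA le.
Qed.

End Coxeter.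

(** * Linear algebra over possibly infinite families *)

Section LinearAlgebra.
Variables (C : fieldType) (V : lmodType C).

Definition lspan (X : set V) : set V :=
  [set v | exists n (a : 'I_n -> C) (x : 'I_n -> V),
     (forall i, X (x i)) /\ v = \sum_(i < n) a i *: x i].

Definition is_basis (I : choiceType) (e : I -> V) : Prop :=
  (forall (s : seq I) (a : I -> C), uniq s ->
     \sum_(i <- s) a i *: e i = 0 -> forall i, i \in s -> a i = 0)
  /\ (forall v, lspan (range e) v).

Lemma lspan_in (X : set V) v : X v -> lspan X v.
Proof.
move=> Xv; exists 1%N, (fun=> 1), (fun=> v); split => //.
by rewrite big_ord1 scale1r.
Qed.

End LinearAlgebra.

(** * Right modules over subalgebras, and first extension groups *)

Section Modules.
Variables (C : fieldType) (H : algType C).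

(** Right modules over a subalgebra [A] of [H]; the values of the action
    outside [A] are irrelevant. *)
Record rmodule (A : set H) (V : lmodType C) := Rmodule {
  ract :> V -> H -> V;
  ract_linl : forall X, A X -> linear (ract^~ X);
  ract_linr : forall v a X Y, A X -> A Y ->
    ract v (a *: X + Y) = a *: ract v X + ract v Y;
  ract1 : forall v, ract v 1 = v;
  ractM : forall v X Y, A X -> A Y -> ract (ract v X) Y = ract v (X * Y) }.

Definition rmod_hom (A : set H) (V U : lmodType C)
    (M : rmodule A V) (N : rmodule A U) (f : V -> U) : Prop :=
  linear f /\ forall v X, A X -> f (M v X) = N (f v) X.

Definition rmod_simple (A : set H) (V : lmodType C) (M : rmodule A V) : Prop :=
  (exists v : V, v <> 0) /\
  forall U : set V, U 0 -> (forall a u v, U u -> U v -> U (a *: u + v)) ->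
    (forall u X, A X -> U u -> U (M u X)) -> U = [set 0] \/ U = setT.

Definition rrestr (A B : set H) (AB : A `<=` B) (V : lmodType C)
  (M : rmodule B V) : rmodule A V :=
  {| ract := M;
     ract_linl := fun X AX => ract_linl M (AB X AX);
     ract_linr := fun v a X Y AX AY => ract_linr M v a (AB X AX) (AB Y AY);
     ract1 := ract1 M;
     ractM := fun v X Y AX AY => ractM M v (AB X AX) (AB Y AY) |}.

(** Short exact sequences [0 -> N -> E -> M -> 0]. *)
Record extension (A : set H) (V U : lmodType C)
    (M : rmodule A V) (N : rmodule A U) := Extension {
  ext_sort : lmodType C;
  ext_mod :> rmodule A ext_sort;
  ext_inj : U -> ext_sort;
  ext_proj : ext_sort -> V;
  ext_inj_hom : rmod_hom N ext_mod ext_inj;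
  ext_proj_hom : rmod_hom ext_mod M ext_proj;
  ext_injI : injective ext_inj;
  ext_projS : forall v, exists e, ext_proj e = v;
  ext_exact : forall e, ext_proj e = 0 <-> exists n, ext_inj n = e }.

Arguments ext_inj {A V U M N} E : rename.
Arguments ext_proj {A V U M N} E : rename.

Section Ext1.
Variables (A : set H) (V U : lmodType C) (M : rmodule A V) (N : rmodule A U).

Definition ext_equiv (E F : extension M N) : Prop :=
  exists f : ext_sort E -> ext_sort F,
    [/\ rmod_hom E F f, bijective f, forall n, f (ext_inj E n) = ext_inj F n
      & forall e, ext_proj F (f e) = ext_proj E e].

Definition ext_class (E : extension M N) : extension M N -> Prop :=
  fun F => ext_equiv E F.

(** Yoneda's [Ext^1_A(M, N)]: the type of equivalence classes of
    extensions. *)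
Definition Ext1 : Type :=
  {c : extension M N -> Prop | exists E, c = ext_class E}.

Definition Ext1_of (E : extension M N) : Ext1 :=
  exist _ (ext_class E) (ex_intro _ E erefl).

Lemma ext_equiv_refl E : ext_equiv E E.
Proof. by exists id; split=> //; exact: inv_bij. Qed.

Lemma ext_equiv_sym E F : ext_equiv E F -> ext_equiv F E.
Proof.
move=> [f [[fl fA] [g gK fK] fi fp]]; exists g; split.
- split; first by move=> a u v; rewrite -{1}(fK u) -{1}(fK v) -fl gK.
  by move=> v X AX; rewrite -{1}(fK v) -fA // gK.
- by exists f.
- by move=> n; rewrite -fi gK.
- by move=> e; rewrite -fp fK.
Qed.

Lemma ext_equiv_trans E F G :
  ext_equiv E F -> ext_equiv F G -> ext_equiv E G.
Proof.
move=> [f [[fl fA] fb fi fp]] [g [[gl gA] gb gi gp]].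
exists (g \o f); split.
- split; first by move=> a u v /=; rewrite fl gl.
  by move=> v X AX /=; rewrite fA // gA.
- exact: bij_comp.
- by move=> n /=; rewrite fi gi.
- by move=> e /=; rewrite gp fp.
Qed.

Lemma eq_ext_class E F : ext_equiv E F -> ext_class E = ext_class F.
Proof.
move=> EF; apply/funext => G; apply/propext.
by split; apply: ext_equiv_trans => //; exact: ext_equiv_sym.
Qed.

Lemma Ext1_eq (c d : Ext1) : sval c = sval d -> c = d.
Proof. by case: c d => [c ?] [d ?] /= e; exact: eq_exist. Qed.

Lemma Ext1_of_eq E F : ext_equiv E F -> Ext1_of E = Ext1_of F.
Proof. by move=> EF; apply: Ext1_eq; exact: eq_ext_class. Qed.

Lemma Ext1_ofP (c : Ext1) : exists E, c = Ext1_of E.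
Proof. by case: c => c [E cE]; exists E; exact: Ext1_eq. Qed.

End Ext1.

Section ExtRestriction.
Variables (A B : set H) (AB : A `<=` B).
Variables (V U : lmodType C) (M : rmodule B V) (N : rmodule B U).

Definition ext_restr (E : extension M N) :
  extension (rrestr AB M) (rrestr AB N).
Proof.
exists (ext_sort E) (rrestr AB E) (ext_inj E) (ext_proj E).
- by have [il iB] := ext_inj_hom E; split=> // n X /AB; exact: iB.
- by have [pl pB] := ext_proj_hom E; split=> // e X /AB; exact: pB.
- exact: ext_injI.
- exact: ext_projS.
- exact: ext_exact.
Defined.

Lemma ext_restr_equiv E F :
  ext_equiv E F -> ext_equiv (ext_restr E) (ext_restr F).
Proof.
move=> [f [[fl fB] fb fi fp]]; exists f; split=> //.
by split=> // v X /AB; exact: fB.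
Qed.

Lemma Ext1_restr_subproof (c : Ext1 M N) : exists E,
  (fun F => exists2 E', sval c E' & ext_equiv (ext_restr E') F) = ext_class E.
Proof.
have [E ->] := Ext1_ofP c; exists (ext_restr E).
apply/funext => F; apply/propext; split=> [[E' /ext_restr_equiv EE' E'F]|EF].
  exact: ext_equiv_trans E'F.
by exists E => //; exact: ext_equiv_refl.
Qed.

(** The restriction map [Ext^1_B(M, N) -> Ext^1_A(M, N)]. *)
Definition Ext1_restr (c : Ext1 M N) : Ext1 (rrestr AB M) (rrestr AB N) :=
  exist _ _ (Ext1_restr_subproof c).

Lemma Ext1_restr_of E : Ext1_restr (Ext1_of E) = Ext1_of (ext_restr E).
Proof.
apply/Ext1_eq/funext => F; apply/propext.
split=> [[E' /ext_restr_equiv EE' E'F]|EF]; first exact: ext_equiv_trans E'F.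
by exists E => //; exact: ext_equiv_refl.
Qed.

End ExtRestriction.

(** An invertible element of [B] normalizing the subalgebra [A]. *)
Record normalizing (A B : set H) := Normalizing {
  nz : H;
  nzV : H;
  nz_in : B nz;
  nzV_in : B nzV;
  nzK : nz * nzV = 1;
  nzVK : nzV * nz = 1;
  nz_conj : forall X, A X -> A (nz * X * nzV) }.

Section ExtTwist.
Variables (A B : set H) (AB : A `<=` B) (u : normalizing A B).
Variables (V U : lmodType C) (M : rmodule B V) (N : rmodule B U).

(** The action [(f u)(k) = f(k u^-1) u] of [u] on [Hom_A(K, N)]. *)
Definition hom_act (Z : lmodType C) (K : rmodule B Z) (f : Z -> U) : Z -> U :=
  fun k => N (f (K k (nzV u))) (nz u).

Local Notation MA := (rrestr AB M).
Local Notation NA := (rrestr AB N).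

Definition twist_mod (E : lmodType C) (actE : rmodule A E) : rmodule A E.
Proof.
exists (fun e X => actE e (nz u * X * nzV u)).
- by move=> X AX; apply: ract_linl; exact: nz_conj.
- move=> v a X Y AX AY.
  rewrite mulrDr mulrDl -scalerAr -scalerAl.
  by rewrite ract_linr //; exact: nz_conj.
- by move=> v; rewrite mulr1 nzK ract1.
- move=> v X Y AX AY; rewrite ractM; try exact: nz_conj.
  by congr (actE v _); rewrite !mulrA -[_ * nzV u * nz u]mulrA nzVK mulr1.
Defined.

(** The action of [u] on extensions induced by the action on [Hom_A]: twist
    [E] by conjugation by [u], and compose its two maps with the
    identifications [n |-> n u^-1] and [m |-> m u] of [N] and [M] with their
    twists.  [ext_act_pushout] compares it with [hom_act]. *)
Definition ext_act (E : extension MA NA) : extension MA NA.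
Proof.
exists (ext_sort E) (twist_mod E) (fun n => ext_inj E (N n (nzV u)))
  (fun e => M (ext_proj E e) (nz u)).
- have [il iA] := ext_inj_hom E; split.
    by move=> a n n'; rewrite (ract_linl N (nzV_in u)) il.
  move=> n X AX /=; rewrite -iA /=; last exact: nz_conj.
  have BX := AB AX; have BuX := AB (nz_conj u AX).
  congr (ext_inj E _); rewrite !ractM //; try exact: nzV_in.
  by rewrite !mulrA nzVK mul1r.
- have [pl pA] := ext_proj_hom E; split.
    by move=> a e e'; rewrite pl (ract_linl M (nz_in u)).
  move=> e X AX /=; rewrite pA /=; last exact: nz_conj.
  have BX := AB AX; have BuX := AB (nz_conj u AX).
  rewrite !ractM //; try exact: nz_in.
  by rewrite -!mulrA nzVK mulr1.
- move=> n n' /ext_injI /(congr1 (N^~ (nz u))).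
  by rewrite !ractM ?nzVK ?ract1 //; try exact: nzV_in; try exact: nz_in.
- move=> v; have [e pe] := ext_projS E (M v (nzV u)); exists e.
  by rewrite pe ractM ?nzVK ?ract1 //; try exact: nzV_in; try exact: nz_in.
- move=> e; split.
    move=> /(congr1 (M^~ (nzV u))).
    rewrite ractM ?nzK ?ract1; try exact: nzV_in; try exact: nz_in.
    have /(_ (-1) 0 0) := ract_linl M (nzV_in u).
    rewrite scaler0 addr0 scaleN1r addNr => ->.
    move=> /ext_exact [n <-]; exists (N n (nz u)).
    by rewrite ractM ?nzK ?ract1 //; try exact: nzV_in; try exact: nz_in.
  move=> [n en]; have /ext_exact -> : exists n, ext_inj E n = e.
    by exists (N n (nzV u)).
  have /(_ (-1) 0 0) := ract_linl M (nz_in u).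
  by rewrite scaler0 addr0 scaleN1r addNr.
Defined.

Lemma ext_act_equiv E F : ext_equiv E F -> ext_equiv (ext_act E) (ext_act F).
Proof.
move=> [f [[fl fA] fb fi fp]]; exists f; split=> //=.
- by split=> // e X AX /=; apply: fA; exact: nz_conj.
- by move=> e; rewrite fp.
Qed.

Lemma Ext1_act_subproof (c : Ext1 MA NA) : exists E,
  (fun F => exists2 E', sval c E' & ext_equiv (ext_act E') F) = ext_class E.
Proof.
have [E ->] := Ext1_ofP c; exists (ext_act E).
apply/funext => F; apply/propext; split=> [[E' /ext_act_equiv EE' E'F]|EF].
  exact: ext_equiv_trans E'F.
by exists E => //; exact: ext_equiv_refl.
Qed.

Definition Ext1_act (c : Ext1 MA NA) : Ext1 MA NA :=
  exist _ _ (Ext1_act_subproof c).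

Lemma Ext1_act_of E : Ext1_act (Ext1_of E) = Ext1_of (ext_act E).
Proof.
apply/Ext1_eq/funext => F; apply/propext.
split=> [[E' /ext_act_equiv EE' E'F]|EF]; first exact: ext_equiv_trans E'F.
by exists E => //; exact: ext_equiv_refl.
Qed.

(** Let [0 -> K -> P -> M -> 0] be an exact sequence of [B]-modules.  The
    connecting map [Hom_A(K, N) -> Ext^1_A(M, N)] sends [f] to the class of
    any [E] that receives a morphism [(f, g, id_M)] from the sequence.  If [E]
    represents the image of [f], then [ext_act E] represents the image of
    [f u]: for projective [P] this says that the action on [Ext^1] is induced
    by the one on [Hom]. *)
Lemma ext_act_pushout (Z Q : lmodType C) (K : rmodule B Z) (P : rmodule B Q)
    (iota : Z -> Q) (pi : Q -> V) (E : extension MA NA)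
    (f : Z -> U) (g : Q -> ext_sort E) :
  rmod_hom K P iota -> rmod_hom P M pi ->
  rmod_hom (rrestr AB P) E g ->
  (forall k, g (iota k) = ext_inj E (f k)) ->
  (forall x, ext_proj E (g x) = pi x) ->
  let gu x := g (P x (nzV u)) in
  [/\ rmod_hom (rrestr AB P) (ext_act E) gu,
      forall k, gu (iota k) = ext_inj (ext_act E) (hom_act K f k)
    & forall x, ext_proj (ext_act E) (gu x) = pi x].
Proof.
move=> [_ iB] [_ pB] [gl gA] gi gp gu; split.
- split.
    by move=> a x y; rewrite /gu (ract_linl P (nzV_in u)) gl.
  move=> x X AX; rewrite /gu /= -gA /=; last exact: nz_conj.
  have BX := AB AX; have BuX := AB (nz_conj u AX).
  congr (g _); rewrite !ractM //; try exact: nzV_in.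
  by rewrite !mulrA nzVK mul1r.
- move=> k; rewrite /gu /hom_act /= -iB ?gi; last exact: nzV_in.
  by rewrite ractM ?nzK ?ract1 //; try exact: nzV_in; try exact: nz_in.
- move=> x; rewrite /gu /= gp pB; last exact: nzV_in.
  by rewrite ractM ?nzVK ?ract1 //; try exact: nzV_in; try exact: nz_in.
Qed.

(** The restriction of a [B]-extension is fixed by [u]. *)
Lemma ext_act_restr (E : extension M N) :
  ext_equiv (ext_act (ext_restr AB E)) (ext_restr AB E).
Proof.
have Bu := nz_in u; have BV := nzV_in u.
have [il iB] := ext_inj_hom E; have [pl pB] := ext_proj_hom E.
exists (fun e => E e (nz u)); split=> /=.
- split; first exact: ract_linl.
  move=> e X AX /=; have BX := AB AX; have BuX := AB (nz_conj u AX).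
  by rewrite !ractM // -!mulrA nzVK mulr1.
- by exists (fun e => E e (nzV u)) => e /=; rewrite ractM // ?nzK ?nzVK ract1.
- by move=> n; rewrite -iB // ractM // nzVK ract1.
- by move=> e; rewrite pB.
Qed.

End ExtTwist.

End Modules.

(** * The Hecke algebra *)

(** [gW1] is the extension [W(1)] of [W = W_aff ><| Omega] by [Z_kappa]. *)
Record group_datum := GroupDatum {
  gWaff : groupType;
  gSaff : set gWaff;
  gcox : coxeter_system gSaff;
  gOm : groupType;
  gOmC : forall a b : gOm, (a * b = b * a)%g;
  gact : coxeter_action gSaff gOm;
  gZ : finGroupType;
  gZC : forall s t : gZ, (s * t = t * s)%g;
  gW1 : groupType;
  giota : {multiplicative gZ -> gW1};
  gpr : {multiplicative gW1 -> sdprod gact};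
  giota_inj : injective giota;
  gpr_surj : forall x, exists w, gpr w = x;
  gexact : forall w, gpr w = 1%g <-> exists t, giota t = w }.

Section Datum.
Variable D : group_datum.
Local Notation W1 := (gW1 D).
Local Notation Z := (gZ D).
Local Notation iota := (@giota D).
Local Notation pr := (@gpr D).

(** Components of the image of [w] in [W = W_aff ><| Omega]. *)
Definition waff (w : W1) : gWaff D := (pr w).1.
Definition wom (w : W1) : gOm D := (pr w).2.

Definition Waff1 : set W1 := [set w | wom w = 1%g].
Definition Om1 : set W1 := [set w | waff w = 1%g].

Definition lift_of (st : W1) (s : gWaff D) : Prop :=
  waff st = s /\ wom st = 1%g.

Definition Ref1 : set W1 :=
  [set w | exists2 r, reflection (@gSaff D) r & lift_of w r].

Definition ell (w : W1) : nat := cox_length (gcox D) (waff w).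

(** The conjugation action of [W(1)] on [Z_kappa]; the default value is never
    used, see [conjZP]. *)
Definition conjZ (w : W1) (t : Z) : Z :=
  odflt 1%g [pick t' | iota t' == (w * iota t * w^-1)%g].

Lemma wafM v w : waff (v * w) = (waff v * gact D (wom v) (waff w))%g.
Proof. by rewrite /waff gmulfM. Qed.

Lemma womM v w : wom (v * w) = (wom v * wom w)%g.
Proof. by rewrite /wom gmulfM. Qed.

Lemma wom1 : wom 1%g = 1%g.
Proof. by apply: (mulgI (wom 1%g)); rewrite -womM !mulg1. Qed.

Lemma womV w : wom w^-1 = (wom w)^-1%g.
Proof. by apply: (mulgI (wom w)); rewrite -womM !mulgV wom1. Qed.

Lemma waff1 : waff 1%g = 1%g.
Proof.
have := wafM 1%g 1%g; rewrite wom1 cact1 mulg1 => e.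
by apply: (mulgI (waff 1%g)); rewrite -e mulg1.
Qed.

Lemma waffV_Om w : Om1 w -> Om1 w^-1%g.
Proof.
move=> w1; have := wafM w^-1%g w; rewrite mulVg waff1 (w1 : waff w = _).
by rewrite cact_1 mulg1 => /esym.
Qed.

Lemma pr1 : pr 1%g = 1%g.
Proof. by apply: (mulgI (pr 1%g)); rewrite -gmulfM !mulg1. Qed.

Lemma conjZP w t : iota (conjZ w t) = (w * iota t * w^-1)%g.
Proof.
rewrite /conjZ; case: pickP => [t' /eqP //|/= no].
have /gexact[t' et'] : pr (w * iota t * w^-1)%g = 1%g.
  have /gexact e : exists t', iota t' = iota t by exists t.
  by rewrite !gmulfM e mulg1 -gmulfM mulgV; exact: pr1.
by move: (no t'); rewrite et' eqxx.
Qed.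

Lemma iota_waff t : waff (iota t) = 1%g.
Proof. by rewrite /waff (_ : pr _ = 1%g) //; apply/gexact; exists t. Qed.

Lemma iota_wom t : wom (iota t) = 1%g.
Proof. by rewrite /wom (_ : pr _ = 1%g) //; apply/gexact; exists t. Qed.

Lemma Waff1_conj om w : Waff1 w -> Waff1 (om * w * om^-1)%g.
Proof.
by move=> w1; rewrite /Waff1 /= !womM womV (w1 : wom w = _) mulg1 mulgV.
Qed.

Lemma ell_Om om : Om1 om -> ell om = 0%N.
Proof.
rewrite /ell => ->; rewrite /cox_length; case: ex_minnP => n _ /(_ 0%N).
suff h : has_word_of_size (@gSaff D) 1%g 0 by move/(_ h); case: n.
by apply/asboolP; exists [::] => //; split=> //; rewrite big_nil.
Qed.

Lemma ell_Oml om w : Om1 om -> ell (om * w)%g = ell w.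
Proof.
move=> om1; rewrite /ell wafM (om1 : waff om = _) mul1g.
exact: cox_length_act.
Qed.

Lemma ell_Omr om w : Om1 om -> ell (w * om)%g = ell w.
Proof.
by move=> om1; rewrite /ell wafM (om1 : waff om = _) cact_1 mulg1.
Qed.

Variable C : fieldType.

(** The group algebra [C[Z_kappa]] is represented by coefficient functions;
    only left translation by [Z_kappa] and conjugation by [W(1)] are
    needed. *)
Definition gaZ := {ffun Z -> C}.
Definition ga_trans (t : Z) (a : gaZ) : gaZ := [ffun x => a (t^-1 * x)%g].
Definition ga_conj (w : W1) (a : gaZ) : gaZ := [ffun x => a (conjZ w^-1 x)].

Record parameter := MkParameter {
  par :> W1 -> gaZ;
  par_conj : forall w s, Ref1 s -> par (w * s * w^-1)%g = ga_conj w (par s);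
  par_trans : forall t s, Ref1 s -> par (iota t * s)%g = ga_trans t (par s) }.

Record hecke (c : parameter) := Hecke {
  halg :> algType C;
  hT : W1 -> halg;
  hT_basis : is_basis hT;
  hTM : forall v w, ell (v * w)%g = (ell v + ell w)%N ->
    hT (v * w)%g = hT v * hT w;
  hT_quad : forall s st, gSaff s -> lift_of st s ->
    hT st * hT st = (\sum_(t : Z) c st t *: hT (iota t)) * hT st }.

Definition is_charZ (chi : Z -> C) : Prop :=
  chi 1%g = 1 /\ forall s t, chi (s * t)%g = chi s * chi t.

Definition chi_ext (chi : Z -> C) (a : gaZ) : C := \sum_(t : Z) a t * chi t.

Variable c : parameter.

Definition Saff_chi (chi : Z -> C) : set (gWaff D) :=
  [set s | gSaff s /\ forall st, lift_of st s -> chi_ext chi (c st) != 0].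

Variable H : hecke c.
Local Notation T := (hT H).

Definition Haff : set H := lspan (T @` Waff1).

(** Characters of [H^aff] are represented by functions on [H], of which only
    the values on [H^aff] matter. *)
Record is_char_aff (Xi : H -> C) : Prop := IsCharAff {
  ca_lin : forall a X Y, Haff X -> Haff Y -> Xi (a *: X + Y) = a * Xi X + Xi Y;
  ca_1 : Xi 1 = 1;
  ca_mul : forall X Y, Haff X -> Haff Y -> Xi (X * Y) = Xi X * Xi Y }.

(** [Xi] is the character [Xi_{J, chi}]. *)
Record is_Xi (J : set (gWaff D)) (chi : Z -> C) (Xi : H -> C) : Prop := IsXi {
  Xi_char : is_char_aff Xi;
  Xi_Z : forall t, Xi (T (iota t)) = chi t;
  Xi_notin : forall s st, gSaff s -> ~ J s -> lift_of st s ->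
    Xi (T st) = chi_ext chi (c st);
  Xi_in : forall s st, J s -> lift_of st s -> Xi (T st) = 0 }.

Definition stab1 (Xi : H -> C) : set W1 :=
  [set om | Om1 om /\
    forall w, Waff1 w -> Xi (T (om * w * om^-1)%g) = Xi (T w)].

(** Since [Xi om] depends only on the image of [om] in [Omega], this image
    is the stabilizer of [Xi] in [Omega]. *)
Definition stab (Xi : H -> C) : set (gOm D) := wom @` stab1 Xi.

Definition COm (Xi : H -> C) : set H := lspan (T @` stab1 Xi).

Definition HXi (Xi : H -> C) : set H :=
  lspan [set h | exists X Y, [/\ Haff X, COm Xi Y & h = X * Y]].

Definition HXi2 (Xi Xi' : H -> C) : set H := HXi Xi `&` HXi Xi'.

(** The preimage of [Omega_{Xi, Xi'}] in [Omega(1)]. *)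
Definition pre_stab2 (Xi Xi' : H -> C) : set W1 :=
  [set om | Om1 om /\ (stab Xi `&` stab Xi') (wom om)].

Lemma hT1 : T 1%g = 1.
Proof.
have e w : T 1%g * T w = T w.
  by rewrite -hTM ?mul1g // (ell_Om waff1) add0n.
have [_ /(_ 1)[n [a [x [xT e1]]]]] := hT_basis H.
rewrite -[LHS]mulr1 {1}e1 mulr_sumr [RHS]e1; apply: eq_bigr => i _.
by have [w _ <-] := xT i; rewrite -scalerAr e.
Qed.

Lemma hT_Oml om w : Om1 om -> T (om * w)%g = T om * T w.
Proof. by move=> om1; rewrite hTM // ell_Oml // (ell_Om om1). Qed.

Lemma hT_Omr om w : Om1 om -> T (w * om)%g = T w * T om.
Proof. by move=> om1; rewrite hTM // ell_Omr // (ell_Om om1) addn0. Qed.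

Lemma Haff_conj om X : Om1 om -> Haff X -> Haff (T om * X * T om^-1%g).
Proof.
move=> om1 [n [a [x [xT ->]]]].
exists n, a, (fun i => T om * x i * T om^-1%g); split.
  move=> i; have [w w1 <-] := xT i.
  exists (om * w * om^-1)%g; first exact: Waff1_conj.
  by rewrite hT_Omr ?hT_Oml //; exact: waffV_Om.
rewrite mulr_sumr mulr_suml; apply: eq_bigr => i _.
by rewrite -scalerAr -scalerAl.
Qed.

Lemma stab1_1 Xi : stab1 Xi 1%g.
Proof.
by split=> [|w _]; [exact: waff1 | rewrite mul1g invg1 mulg1].
Qed.

Lemma stab1_V Xi om : stab1 Xi om -> stab1 Xi om^-1%g.
Proof.
move=> [om1 omXi]; split; first exact: waffV_Om.
move=> w w1; rewrite -[LHS]omXi; last exact: Waff1_conj.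
by rewrite invgK !mulgA mulgV mul1g -mulgA mulgV mulg1.
Qed.

Lemma stabV Xi o : stab Xi o -> stab Xi o^-1%g.
Proof.
by move=> [om /stab1_V omV <-]; exists om^-1%g => //; rewrite womV.
Qed.

Lemma Haff_sub_HXi Xi : Haff `<=` HXi Xi.
Proof.
move=> X HX; apply: lspan_in; exists X, 1; split=> //; last by rewrite mulr1.
by apply: lspan_in; exists 1%g; [exact: stab1_1 | exact: hT1].
Qed.

Lemma HXi_T Xi om : Om1 om -> stab Xi (wom om) -> HXi Xi (T om).
Proof.
move=> om1 [om0 s0 e]; have [om01 _] := s0.
have pe : pr om0 = pr om.
  rewrite [LHS]surjective_pairing [RHS]surjective_pairing.
  by congr pair; [rewrite [LHS]om01 [RHS]om1 | exact: e].
have /gexact[t et] : pr (om * om0^-1)%g = 1%g.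
  by rewrite gmulfM -pe -gmulfM mulgV; exact: pr1.
apply: lspan_in; exists (T (iota t)), (T om0); split.
- by apply: lspan_in; exists (iota t) => //; exact: iota_wom.
- by apply: lspan_in; exists om0.
- rewrite -hT_Oml; last exact: iota_waff.
  by rewrite et -mulgA mulVg mulg1.
Qed.

Section Pair.
Variables Xi Xi' : H -> C.

Lemma Haff_sub_HXi2 : Haff `<=` HXi2 Xi Xi'.
Proof. by move=> X HX; split; exact: Haff_sub_HXi. Qed.

Lemma HXi2_subl : HXi2 Xi Xi' `<=` HXi Xi.
Proof. by move=> X []. Qed.

Lemma HXi2_subr : HXi2 Xi Xi' `<=` HXi Xi'.
Proof. by move=> X []. Qed.

Lemma HXi2_T om : pre_stab2 Xi Xi' om -> HXi2 Xi Xi' (T om).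
Proof. by move=> [om1 [s s']]; split; exact: HXi_T. Qed.

Lemma pre_stab2V om : pre_stab2 Xi Xi' om -> pre_stab2 Xi Xi' om^-1%g.
Proof.
move=> [om1 [s s']]; split; first exact: waffV_Om.
by rewrite womV; split; exact: stabV.
Qed.

Lemma pre_stab2_TK om : pre_stab2 Xi Xi' om -> T om * T om^-1%g = 1.
Proof. by move=> [om1 _]; rewrite -hT_Oml // mulgV hT1. Qed.

Lemma pre_stab2_TVK om : pre_stab2 Xi Xi' om -> T om^-1%g * T om = 1.
Proof. by move=> [om1 _]; rewrite -hT_Omr // mulVg hT1. Qed.

Definition pre_stab2_unit (om : W1) (om2 : pre_stab2 Xi Xi' om) :
    normalizing Haff (HXi2 Xi Xi') :=
  {| nz := T om;
     nzV := T om^-1%g;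
     nz_in := HXi2_T om2;
     nzV_in := HXi2_T (pre_stab2V om2);
     nzK := pre_stab2_TK om2;
     nzVK := pre_stab2_TVK om2;
     nz_conj := fun X => Haff_conj (proj1 om2) |}.

Variables (V V' : lmodType C).
Variables (M : rmodule (HXi2 Xi Xi') V) (N : rmodule (HXi2 Xi Xi') V').

(** [Ext^1_{H^aff}(M, N)^{Omega_{Xi, Xi'}}].  As [Omega_{Xi, Xi'}] acts
    through its preimage in [Omega(1)], invariance is required under the
    latter. *)
Definition Ext1_aff_inv : Type :=
  {x : Ext1 (rrestr Haff_sub_HXi2 M) (rrestr Haff_sub_HXi2 N) |
     forall om (om2 : pre_stab2 Xi Xi' om),
       Ext1_act (pre_stab2_unit om2) x = x}.

Lemma Ext1_restr_inv (x : Ext1 M N) om (om2 : pre_stab2 Xi Xi' om) :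
  Ext1_act (pre_stab2_unit om2) (Ext1_restr Haff_sub_HXi2 x) =
  Ext1_restr Haff_sub_HXi2 x.
Proof.
have [E ->] := Ext1_ofP x; rewrite Ext1_restr_of Ext1_act_of.
by apply: Ext1_of_eq; exact: ext_act_restr.
Qed.

(** The restriction map
    [Ext^1_{H_{Xi, Xi'}}(M, N) -> Ext^1_{H^aff}(M, N)^{Omega_{Xi, Xi'}}]. *)
Definition Ext1_res_inv (x : Ext1 M N) : Ext1_aff_inv :=
  exist _ (Ext1_restr Haff_sub_HXi2 x) (@Ext1_restr_inv x).

End Pair.

Section Simple.
Variables (Xi : H -> C) (V : lmodType C).

(** The restriction of [V] to [Z_kappa] is a direct sum of copies of [chi]:
    a basis of [V] consists of [chi]-eigenvectors. *)
Definition isotypicZ (chi : Z -> C) (M : rmodule (COm Xi) V) : Prop :=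
  exists (I : choiceType) (e : I -> V), is_basis e /\
    forall i t, M (e i) (T (iota t)) = chi t *: e i.

(** [M] is the [H_Xi]-module [Xi (x) V]: as [Xi] is one-dimensional, the
    underlying space is [V], with [1 (x) y] identified with [y].  The action
    is determined by this condition because the products [X * Y] span
    [H_Xi]. *)
Definition is_Xi_tensor (rV : rmodule (COm Xi) V) (M : rmodule (HXi Xi) V) :
    Prop :=
  forall v X Y, Haff X -> COm Xi Y -> M v (X * Y) = Xi X *: rV v Y.

End Simple.

End Datum.

(* Main.v *)
From HB Require Import structures.
Require Import Defs.
From mathcomp Require Import all_boot all_order all_fingroup all_algebra cyclic.
From mathcomp Require Import boolp classical_sets functions.

Local Open Scope classical_set_scope.
Local Open Scope ring_scope.

Import GRing.Theory.

Set Implicit Arguments.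
Unset Strict Implicit.

(** An [H^aff]-extension [E] of [M = Xi (x) V] by [N = Xi' (x) V'] extends to
    [H_{Xi,Xi'}] as soon as the elements [om] of the preimage of
    [Omega_{Xi,Xi'}] act on [E] compatibly with conjugation on [H^aff] and with
    [T_t] for [t] in [Z_kappa].  Invariance of the class of [E] gives for each
    [om] an automorphism [f_om] of [E] that is semilinear for this conjugation,
    and the question is multiplicativity in [om].  If [Xi] and [Xi'] differ on
    [H^aff], then [Hom_{H^aff}(M, N) = 0], so [f_om] is unique and hence
    multiplicative.  If they agree, then a vector space splitting [E = N + M]
    describes [E] by a derivation that does not depend on the splitting; hence
    the derivation itself is invariant, and [om] can act diagonally on [N + M].
    The derivation vanishes on [Z_kappa], whose order is invertible in [C]. *)

(** * Spans, and linear maps defined on a basis *)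

Section Span.
Variables (C : fieldType) (V : lmodType C).
Implicit Types X : set V.

Lemma lspan0 X : lspan X 0.
Proof.
exists 0%N, (fun=> 0), (fun=> 0); split; first by case.
by rewrite big_ord0.
Qed.

Lemma lspan_linear X a u v : lspan X u -> lspan X v -> lspan X (a *: u + v).
Proof.
move=> [n [b [x [xX ->]]]] [m [d [y [yX ->]]]].
exists (n + m)%N, (fun i => match fintype.split i with
    inl j => a * b j | inr j => d j end),
  (fun i => match fintype.split i with inl j => x j | inr j => y j end); split.
  by move=> i; case: fintype.split.
rewrite big_split_ord /= scaler_sumr; congr (_ + _); apply: eq_bigr => i _.
  by rewrite (unsplitK (inl i)) scalerA.
by rewrite (unsplitK (inr i)).
Qed.

Lemma lspan_sum X (I : Type) (r : seq I) (F : I -> V) :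
  (forall i, lspan X (F i)) -> lspan X (\sum_(i <- r) F i).
Proof.
move=> XF; elim/big_ind: _ => // [|u v Xu Xv]; first exact: lspan0.
by rewrite -[u]scale1r; exact: lspan_linear.
Qed.

Lemma lspanZ X a u : lspan X u -> lspan X (a *: u).
Proof.
by move=> Xu; rewrite -[_ *: _]addr0; apply: lspan_linear => //; exact: lspan0.
Qed.

Lemma lspan_ind X (P : V -> Prop) :
  P 0 -> (forall x, X x -> P x) ->
  (forall a u v, lspan X u -> lspan X v -> P u -> P v -> P (a *: u + v)) ->
  forall v, lspan X v -> P v.
Proof.
move=> P0 PX PD v [n [a [x [xX ->]]]].
(* Span membership is proved along with [P], since [PD] asks for it at each partial sum. *)
have [] // : lspan X (\sum_(i < n) a i *: x i) /\ P (\sum_(i < n) a i *: x i).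
elim/big_rec: _ => [|i w _ [Xw Pw]]; first by split; first exact: lspan0.
have Xi : lspan X (x i) by exact: lspan_in.
by split; [exact: lspan_linear | apply: PD => //; exact: PX].
Qed.

Lemma sub_lspan X Y v : X `<=` lspan Y -> lspan X v -> lspan Y v.
Proof.
move=> XY; move: v; apply: lspan_ind => //; first exact: lspan0.
by move=> a u v _ _; exact: lspan_linear.
Qed.

End Span.

Section LinearExtension.
Variables (C : fieldType) (V U : lmodType C) (I : choiceType) (e : I -> V).
Hypothesis eB : is_basis e.

(** Repeated indices are allowed in the list, so that combinations are added by concatenation. *)
Let comb (W : lmodType C) (f : I -> W) (l : seq (C * I)) : W :=
  \sum_(p <- l) p.1 *: f p.2.

Lemma basis_comb v : exists l, v = comb e l.
Proof.
have [n [a [x [xe ->]]]] := eB.2 v.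
have /choice[w we] : forall i, exists j, e j = x i.
  by move=> i; have [j _ <-] := xe i; exists j.
exists [seq (a i, w i) | i <- index_enum 'I_n].
by rewrite /comb big_map; apply: eq_bigr => i _ /=; rewrite we.
Qed.

(** Merging repeated indices brings a combination to the duplicate-free form for which [is_basis]
    states independence. *)
Lemma comb_collect (W : lmodType C) (f : I -> W) l :
  comb f l = \sum_(j <- undup [seq p.2 | p <- l])
    (\sum_(p <- l | p.2 == j) p.1) *: f j.
Proof.
under eq_bigr => j _ do rewrite scaler_suml.
rewrite (exchange_big_dep predT) //= /comb big_seq [RHS]big_seq.
apply: eq_bigr => p pl; rewrite big_mkcond.
rewrite (bigD1_seq p.2) ?undup_uniq ?mem_undup ?map_f //= eqxx big1 ?addr0 //.
by move=> j; rewrite eq_sym => /negPf ->.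
Qed.

Lemma comb_free (f : I -> U) l : comb e l = 0 -> comb f l = 0.
Proof.
rewrite !comb_collect => /(eB.1 _ _ (undup_uniq _)) l0.
by rewrite big_seq big1 // => j /l0 ->; rewrite scale0r.
Qed.

(** Each [v] gets an arbitrarily chosen expansion; [comb_free], applied to the difference of two
    expansions of [v], shows that the choice does not affect the value, and linearity follows. *)
Lemma basis_extend (f : I -> U) :
  exists L : {linear V -> U}, forall i, L (e i) = f i.
Proof.
have [l lP] := choice basis_comb.
have wd v k : v = comb e k -> comb f (l v) = comb f k.
  move=> vk; have : comb f (l v ++ [seq (- p.1, p.2) | p <- k]) = 0.
    apply: comb_free; rewrite /comb big_cat big_map /=.
    under [X in _ + X]eq_bigr => p _ do rewrite scaleNr.
    by rewrite sumrN -!/(comb _ _) -lP -vk subrr.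
  rewrite /comb big_cat big_map /=.
  under [X in _ + X]eq_bigr => p _ do rewrite scaleNr.
  by rewrite sumrN => /subr0_eq.
have Llin : linear (fun v => comb f (l v)).
  move=> a u v /=.
  rewrite (wd _ ([seq (a * p.1, p.2) | p <- l u] ++ l v)).
    rewrite /comb big_cat big_map scaler_sumr /=; congr (_ + _).
    by apply: eq_bigr => p _; rewrite scalerA.
  rewrite {1}(lP u) {1}(lP v) /comb big_cat big_map scaler_sumr /=.
  by congr (_ + _); apply: eq_bigr => p _; rewrite scalerA.
pose mL := GRing.isLinear.Build C V U *:%R _ Llin.
exists (HB.pack (fun v => comb f (l v)) mL : {linear V -> U}) => i /=.
by rewrite (wd _ [:: (1, i)]) /comb big_seq1 /= scale1r.
Qed.

End LinearExtension.

(** The linear map that kills the basis vectors outside [A] and fixes the others is the identity on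
    the span of [A] and sends the span of [B] into that of the intersection. *)
Lemma lspan_basisI (C : fieldType) (V : lmodType C) (I : choiceType)
    (e : I -> V) (A B : set I) v : is_basis e ->
  lspan (e @` A) v -> lspan (e @` B) v -> lspan (e @` (A `&` B)) v.
Proof.
move=> eB Av Bv.
have [L Le] := basis_extend eB (fun i => if `[< A i >] then e i else 0).
have <- : L v = v.
  move: v Av {Bv}; apply: lspan_ind; first exact: linear0.
    by move=> _ [i Ai <-]; rewrite Le asboolT.
  by move=> a u v _ _; rewrite linearP => -> ->.
move: v Bv {Av}; apply: lspan_ind.
- by rewrite linear0; exact: lspan0.
- move=> _ [i Bi <-]; rewrite Le; case: asboolP => Ai; last exact: lspan0.
  by apply: lspan_in; exists i.
- by move=> a u v _ _; rewrite linearP; exact: lspan_linear.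
Qed.

(** * Parity and variation of the Coxeter length *)

Section CoxeterLength.
Variables (W : groupType) (S : set W) (cS : coxeter_system S).

Lemma cox_length_le l w : is_word S l w -> (cox_length cS w <= size l)%N.
Proof.
move=> lw; rewrite /cox_length; case: ex_minnP => n _; apply.
by apply/asboolP; exists l.
Qed.

Lemma cox_lengthP w : exists2 l, is_word S l w & size l = cox_length cS w.
Proof. by rewrite /cox_length; case: ex_minnP => n /asboolP. Qed.

Lemma cox_length_parity l w :
  is_word S l w -> odd (cox_length cS w) = odd (size l).
Proof.
(* [phi] is the sign character. *)
have [s t n _ _ _|phi phiS] := cox_univ cS (f := fun=> tperm false true).
  by rewrite tperm2 expg1n.
have phiP k v : is_word S k v -> odd (size k) = phi v :> bool.
  move=> [kS ->]; elim: k kS => [|s k IH] kS.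
    rewrite big_nil (_ : phi 1%g = 1%g) ?odd_perm1 //.
    by apply: (mulgI (phi 1%g)); rewrite -gmulfM !mulg1.
  rewrite big_cons gmulfM odd_permM phiS ?odd_tperm //=; last first.
    by apply: kS; rewrite mem_head.
  by rewrite -IH // => t tk; apply: kS; rewrite in_cons tk orbT.
have [k kw <-] := cox_lengthP w.
by move=> lw; rewrite (phiP _ _ kw) (phiP _ _ lw).
Qed.

(** Left multiplication by the involution [s] changes the length by at most one in either direction,
    and parity excludes equality. *)
Lemma cox_length_mull s w : S s ->
  cox_length cS (s * w)%g = (cox_length cS w).+1 \/
  cox_length cS w = (cox_length cS (s * w)%g).+1.
Proof.
move=> Ss; have le v : (cox_length cS (s * v)%g <= (cox_length cS v).+1)%N.
  have [l [lS lv] <-] := cox_lengthP v.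
  apply: (@cox_length_le (s :: l)); split; last by rewrite big_cons lv.
  by move=> t; rewrite in_cons => /orP[/eqP -> //|/lS].
have ne : odd (cox_length cS (s * w)%g) = ~~ odd (cox_length cS w).
  have [l [lS lv] <-] := cox_lengthP w.
  apply: (@cox_length_parity (s :: l)); split; last by rewrite big_cons lv.
  by move=> t; rewrite in_cons => /orP[/eqP -> //|/lS].
have := le (s * w)%g; rewrite mulgA (cox_invol cS Ss).2 mul1g.
move: (le w); rewrite leq_eqVlt ltnS => /orP[/eqP -> //|]; first by left.
rewrite leq_eqVlt => /orP[/eqP e|lt ge]; last first.
  by right; apply/eqP; rewrite eqn_leq ge.
by move: ne; rewrite e; case: odd.
Qed.

End CoxeterLength.

(** * Products and spanning sets in the Hecke algebra *)

Section HeckeSpans.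
Variables (D : group_datum) (C : fieldType) (c : parameter D C) (H : hecke c).
Local Notation W1 := (gW1 D).
Local Notation T := (hT H).
Implicit Types (v w st om : W1) (Xi : H -> C).

Lemma Haff_T w : Waff1 w -> Haff (T w : H).
Proof. by move=> w1; apply: lspan_in; exists w. Qed.

Lemma Waff1M v w : Waff1 v -> Waff1 w -> Waff1 (v * w)%g.
Proof. by rewrite /Waff1 /= womM => -> ->; rewrite mulg1. Qed.

Lemma Waff1V v : Waff1 v -> Waff1 v^-1%g.
Proof. by rewrite /Waff1 /= womV => ->; rewrite invg1. Qed.

Lemma lift_exists (s : gWaff D) : exists st, lift_of st s.
Proof.
have [st e] := gpr_surj (s, 1%g : gOm D); exists st.
by rewrite /lift_of /waff /wom e.
Qed.

Lemma ell_lift s st : gSaff s -> lift_of st s -> ell st = 1%N.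
Proof.
move=> Ss [e _]; have := cox_length_mull (gcox D) 1%g Ss.
have := ell_Om (@waff1 D); rewrite /ell e waff1 => ->.
by rewrite mulg1 => -[].
Qed.

Lemma Haff_TsT s st w : gSaff s -> lift_of st s -> Waff1 w ->
  Haff (T st * T w : H).
Proof.
move=> Ss sts w1; have st1 := sts.2 : Waff1 st.
have lst := ell_lift Ss sts.
have wafst v : waff (st * v)%g = (s * waff v)%g.
  by rewrite wafM sts.1 sts.2 cact1.
have [sN ss] := cox_invol (gcox D) Ss.
case: (cox_length_mull (gcox D) (waff w) Ss) => lw.
  rewrite -hTM; first by apply: Haff_T; exact: Waff1M.
  by rewrite lst /ell wafst lw.
have wE : waff (st^-1 * w)%g = (s * waff w)%g.
  apply: (mulgI s); rewrite mulgA ss mul1g -wafst.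
  by rewrite mulgA mulgV mul1g.
have Tw : T w = T st * T (st^-1 * w)%g.
  rewrite -hTM ?mulgA ?mulgV ?mul1g //.
  by rewrite lst /ell wE.
(* The length drops, so [T_st T_w = c_st T_w]. *)
rewrite {1}Tw mulrA (hT_quad H Ss sts) -mulrA -Tw mulr_suml.
apply: lspan_sum => t; rewrite -scalerAl; apply: lspanZ.
rewrite -hT_Oml; last exact: iota_waff.
by apply: Haff_T; apply: Waff1M => //; exact: iota_wom.
Qed.

(** [Haff] is defined as a span, so closure under products needs a proof: induction on [ell v],
    splitting off the first letter of a reduced word and using [Haff_TsT]. *)
Lemma HaffM (X Y : H) : Haff X -> Haff Y -> Haff (X * Y).
Proof.
have TsH s st Z : gSaff s -> lift_of st s -> Haff Z -> Haff (T st * Z : H).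
  move=> Ss sts; move: Z; apply: lspan_ind.
  - by rewrite mulr0; exact: lspan0.
  - by move=> _ [w w1 <-]; exact: Haff_TsT sts w1.
  - by move=> a U V _ _ HU HV; rewrite mulrDr -scalerAr; exact: lspan_linear.
have TH n v Z : ell v = n -> Waff1 v -> Haff Z -> Haff (T v * Z : H).
  elim: n v => [|n IH] v lv v1 HZ.
    have [l lv1] := cox_lengthP (gcox D) (waff v).
    rewrite -/(ell v) lv => /size0nil le.
    (* An element of length zero has trivial component in [gWaff], and there [T] is
       multiplicative. *)
    have v0 : waff v = 1%g by rewrite lv1.2 le big_nil.
    move: Z HZ; apply: lspan_ind.
    - by rewrite mulr0; exact: lspan0.
    - by move=> _ [w w1 <-]; rewrite -hT_Oml //; apply: Haff_T; exact: Waff1M.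
    - by move=> a U V _ _ HU HV; rewrite mulrDr -scalerAr; exact: lspan_linear.
  have [[|s l] [lS lv1]] := cox_lengthP (gcox D) (waff v);
    rewrite -/(ell v) lv // => -[sl].
  have Ss : gSaff s by apply: lS; rewrite mem_head.
  have [st sts] := lift_exists s; have st1 := sts.2 : Waff1 st.
  have wafE : waff v = (s * waff (st^-1 * v)%g)%g.
    by rewrite -{1}[v](mulKVg st) wafM sts.1 sts.2 cact1.
  (* The rest of the reduced word bounds this length by [n]; since multiplying by [s] gives length
     [n.+1], it cannot be anything else. *)
  have lst : ell (st^-1 * v)%g = n.
    have e : waff (st^-1 * v)%g = (\prod_(t <- l) t)%g.
      by apply: (mulgI s); rewrite -wafE lv1 big_cons.
    have : (ell (st^-1 * v)%g <= n)%N.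
      rewrite -sl; apply: cox_length_le; split=> // t tl.
      by apply: lS; rewrite in_cons tl orbT.
    move: (cox_length_mull (gcox D) (waff (st^-1 * v)%g) Ss).
    rewrite -wafE -!/(ell _) lv => -[[->] //|-> /ltnW].
    by rewrite ltnn.
  rewrite -{1}[v](mulKVg st) hTM; last first.
    by rewrite mulKVg lv lst (ell_lift Ss sts).
  rewrite -mulrA; apply: TsH Ss sts _; apply: IH => //.
  by apply: Waff1M => //; exact: Waff1V.
move=> HX HY; move: X HX; apply: lspan_ind.
- by rewrite mul0r; exact: lspan0.
- by move=> _ [v v1 <-]; exact: TH.
- by move=> a U V _ _ HU HV; rewrite mulrDl -scalerAl; exact: lspan_linear.
Qed.

(** Describes [HXi] through the basis [T], so that [lspan_basisI] can be applied to the intersection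
    [HXi2]. *)
Lemma HXi_span Xi X : HXi Xi X -> lspan (T @` [set w | stab Xi (wom w)]) X.
Proof.
apply: sub_lspan => _ [U [Y [HU HY ->]]].
move: U HU; apply: lspan_ind.
- by rewrite mul0r; exact: lspan0.
- move=> _ [v v1 <-]; move: Y HY; apply: lspan_ind.
  + by rewrite mulr0; exact: lspan0.
  + move=> _ [om om0 <-]; rewrite -hT_Omr; last exact: om0.1.
    apply: lspan_in; exists (v * om)%g => //=.
    by rewrite womM (v1 : wom v = _) mul1g; exists om.
  + by move=> a U V _ _ HU HV; rewrite mulrDr -scalerAr; exact: lspan_linear.
- by move=> a U V _ _ HU HV; rewrite mulrDl -scalerAl; exact: lspan_linear.
Qed.

Lemma Om1_lift w : exists om, Om1 om /\ wom om = wom w.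
Proof.
have [om e] := gpr_surj (1%g : gWaff D, wom w).
by exists om; rewrite /Om1 /= /waff /wom e.
Qed.

(** [om] agrees with an element of [stab1] only up to a factor in [Waff1], which is absorbed into
    [X]. *)
Lemma HXi_mulT Xi X om : Haff X -> Om1 om -> stab Xi (wom om) ->
  HXi Xi (X * T om : H).
Proof.
move=> HX om1 [om0 om0s e].
have z1 : Waff1 (om * om0^-1)%g by rewrite /Waff1 /= womM womV e mulgV.
apply: lspan_in; exists (X * T (om * om0^-1)%g), (T om0); split.
- by apply: HaffM => //; exact: Haff_T.
- by apply: lspan_in; exists om0.
- by rewrite -mulrA -hT_Omr ?mulgVK //; exact: om0s.1.
Qed.

(** An intersection of spans comes without generators. As the [T w] form a basis, it lies in the
    span of those [T w] with [wom w] in both stabilizers, and each of these factors as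
    [T (w * om^-1) * T om] with [om] a lift of [wom w]. *)
Lemma HXi2_ind Xi Xi' (P : H -> Prop) :
  (forall X om, Haff X -> pre_stab2 Xi Xi' om -> P (X * T om)) ->
  (forall a X Y, HXi2 Xi Xi' X -> HXi2 Xi Xi' Y -> P X -> P Y ->
     P (a *: X + Y)) ->
  forall X, HXi2 Xi Xi' X -> P X.
Proof.
move=> PT PD X [/HXi_span HX /HXi_span HX'].
pose G := [set Z | exists Y om, [/\ Haff Y, pre_stab2 Xi Xi' om & Z = Y * T om]].
have GB Z : lspan G Z -> HXi2 Xi Xi' Z.
  move=> GZ; split; move: GZ; apply: sub_lspan => _ [Y [om [HY [om1 [s s']] ->]]];
    exact: HXi_mulT.
have : lspan G X.
  have := lspan_basisI (hT_basis H) HX HX'; apply: sub_lspan => _ [w [sw sw'] <-].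
  have [om [om1 omw]] := Om1_lift w.
  apply: lspan_in; exists (T (w * om^-1)%g), om; split.
  - by apply: Haff_T; rewrite /Waff1 /= womM womV omw mulgV.
  - by split => //; rewrite omw.
  - by rewrite -hT_Omr // mulgVK.
apply: lspan_ind.
(* The zero vector is the product [0 * T 1], an instance of [PT]. *)
- rewrite -(mul0r (T 1%g)); apply: PT; first exact: lspan0.
  split; first exact: waff1.
  by rewrite wom1; split; (exists 1%g; [exact: stab1_1 | exact: wom1]).
- by move=> _ [Y [om [HY omP ->]]]; exact: PT.
- by move=> a U Y /GB BU /GB BY; exact: PD.
Qed.

Lemma stabM Xi a b : stab Xi a -> stab Xi b -> stab Xi (a * b)%g.
Proof.
move=> [v [v1 vXi] <-] [w [w1 wXi] <-]; exists (v * w)%g; last by rewrite womM.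
split; first by rewrite /Om1 /= wafM v1 mul1g w1 cact_1.
move=> x x1; rewrite invMg -!mulgA (mulgA w) (mulgA (w * x)%g) mulgA vXi.
  exact: wXi.
exact: Waff1_conj.
Qed.

Lemma Om1M v w : Om1 v -> Om1 w -> Om1 (v * w)%g.
Proof. by move=> v1 w1; rewrite /Om1 /= wafM v1 mul1g w1 cact_1. Qed.

Lemma pre_stab2M Xi Xi' v w :
  pre_stab2 Xi Xi' v -> pre_stab2 Xi Xi' w -> pre_stab2 Xi Xi' (v * w)%g.
Proof.
move=> [v1 [sv sv']] [w1 [sw sw']]; split; first exact: Om1M.
by rewrite womM; split; exact: stabM.
Qed.

Lemma pre_stab2_iota Xi Xi' t : pre_stab2 Xi Xi' (@giota D t).
Proof.
split; first exact: iota_waff.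
by rewrite iota_wom; split; (exists 1%g; [exact: stab1_1 | exact: wom1]).
Qed.

(** This is the tensor formula at [Y = 1]: [Haff] acts by scalars on [Xi (x) V]. *)
Lemma Xi_tensor_Haff Xi (V : lmodType C) (rV : rmodule (COm Xi) V)
    (M : rmodule (HXi Xi) V) (v : V) (X : H) :
  is_Xi_tensor rV M -> Haff X -> M v X = Xi X *: v.
Proof.
move=> MP HX; rewrite -{1}[X]mulr1 MP ?ract1 //.
by apply: lspan_in; exists 1%g; [exact: stab1_1 | exact: hT1].
Qed.

Lemma giota1 : @giota D 1%g = 1%g.
Proof. by apply: (mulgI (@giota D 1%g)); rewrite -gmulfM !mulg1. Qed.

End HeckeSpans.

(** * Extending a module from [Haff] to [HXi2] *)

Section ModuleGluing.
Variables (D : group_datum) (C : fieldType) (c : parameter D C) (H : hecke c).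
Local Notation W1 := (gW1 D).
Local Notation T := (hT H).
Variables (Xi Xi' : H -> C) (U : lmodType C) (E : rmodule (@Haff _ _ _ H) U).
(** [th om] is the prospective right action of [T om]: hence the order of [v] and [w] in [thM], and
    [th_conj] is the rule [T om * X = (T om * X * T om^-1) * T om]. *)
Variable th : W1 -> U -> U.
Hypothesis th_lin : forall om, pre_stab2 Xi Xi' om -> linear (th om).
Hypothesis thM : forall v w u, pre_stab2 Xi Xi' v -> pre_stab2 Xi Xi' w ->
  th (v * w)%g u = th w (th v u).
Hypothesis th_conj : forall om u X, pre_stab2 Xi Xi' om -> Haff X ->
  E (th om u) X = th om (E u (T om * X * T om^-1%g)).
Hypothesis th_iota : forall t u, th (@giota D t) u = E u (T (@giota D t)).

(* [u (Y T_om) := th om (u Y)] is well defined: [om] is determined by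
   [T_w = Y T_om] up to [Z_kappa], where [th] agrees with [E]. *)
Lemma rmodule_glue : exists R : rmodule (HXi2 Xi Xi') U,
  forall u X om, Haff X -> pre_stab2 Xi Xi' om ->
    R u (X * T om) = th om (E u X).
Proof.
have [om_ om_P] := choice (@Om1_lift D).
have /choice[L LP] : forall u, exists L : {linear H -> U}, forall w,
    L (T w) = th (om_ w) (E u (T (w * (om_ w)^-1)%g)).
  by move=> u; exact: basis_extend (hT_basis H) _.
have LE u X om : Haff X -> pre_stab2 Xi Xi' om -> L u (X * T om) = th om (E u X).
  move=> HX omP; move: X HX; apply: lspan_ind.
  - have /(_ 0 0 0) := ract_linr E u; rewrite scale0r add0r => E0.
    rewrite mul0r linear0; have HX0 := @lspan0 _ _ (T @` (@Waff1 D)).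
    have := ract_linr E u (-1) HX0 HX0; rewrite !scaleN1r !addNr => ->.
    by have := th_lin omP (-1) 0 0; rewrite !scaleN1r !addNr => ->.
  - move=> _ [w w1 <-]; rewrite -hT_Omr; last exact: omP.1.
    rewrite LP; have [] := om_P (w * om)%g; move: (om_ _) => v v1.
    rewrite womM (w1 : wom w = _) mul1g => vom.
    have /gexact[t tE] : @gpr D (v * om^-1)%g = 1%g.
      rewrite [LHS]surjective_pairing -/(waff _) -/(wom _) womM womV vom mulgV.
      by rewrite wafM v1 mul1g (waffV_Om omP.1) cact_1.
    have -> : v = (@giota D t * om)%g by rewrite tE mulgVK.
    have tP := pre_stab2_iota Xi Xi' t.
    rewrite thM // th_iota ractM; last 2 first.
    + apply: Haff_T; rewrite /Waff1 /= !(womM, womV) (w1 : wom w = _) mul1g.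
      by rewrite iota_wom mul1g mulgV.
    + by apply: Haff_T; exact: iota_wom.
    rewrite -hT_Omr; last exact: tP.1.
    by rewrite invMg !mulgA mulgK mulgVK.
  - move=> a X Y HX HY IX IY; rewrite mulrDl -scalerAl linearP IX IY.
    by rewrite ract_linr // th_lin.
have linl X : HXi2 Xi Xi' X -> linear ((fun u => L u)^~ X).
  move: X; apply: HXi2_ind => [X om HX omP|b X Y _ _ IX IY] a u v /=.
    by rewrite !LE // (ract_linl E HX) th_lin.
  by rewrite !linearP IX IY scalerDr addrACA.
have L1 u : L u 1 = u.
  have e : T 1%g = T (@giota D 1%g) by rewrite giota1.
  rewrite -[1]mul1r -(hT1 H) e.
  rewrite LE; last 2 first.
  - by apply: Haff_T; exact: iota_wom.
  - exact: pre_stab2_iota.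
  by rewrite th_iota -e hT1 !ract1.
have LM u X Y : HXi2 Xi Xi' X -> HXi2 Xi Xi' Y -> L (L u X) Y = L u (X * Y).
  move=> BX BY; move: Y BY X BX u.
  apply: HXi2_ind => [Y om HY omP|b Y Z BY BZ IY IZ] X BX.
    move: X BX; apply: HXi2_ind => [X v HX vP|b X Z BX BZ IX IZ] u.
      (* Moving [T v] past [Y] gives [X * T v * (Y * T om) = X * (T v * Y * T v^-1) * T (v * om)],
         which is again of the form treated by [LE]. *)
      have HvY := Haff_conj vP.1 HY.
      rewrite !LE // th_conj // -thM // ractM // -LE; last 2 first.
      - exact: HaffM.
      - exact: pre_stab2M.
      congr (L u _); rewrite hT_Oml; last exact: vP.1.
      by rewrite -!mulrA (mulrA (T v^-1%g)) (pre_stab2_TVK vP) mul1r.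
    have BY : HXi2 Xi Xi' (Y * T om).
      by split; apply: HXi_mulT omP.1 _ => //; case: omP.2.
    rewrite linearP (linl _ BY).
    by rewrite IX IZ mulrDl -scalerAl linearP.
  by move=> u; rewrite linearP IY // IZ // mulrDr -scalerAr linearP.
exists (Rmodule linl (fun u a X Y _ _ => linearP (L u) a X Y) L1 LM).
by move=> u X om HX omP; exact: LE.
Qed.

End ModuleGluing.

Section Modules.
Variables (C : fieldType) (H : algType C) (A : set H) (V : lmodType C).
Variable M : rmodule A V.

Lemma ract0l X : A X -> M 0 X = 0.
Proof. by move=> /(ract_linl M)/(_ (-1) 0 0); rewrite !scaleN1r !addNr. Qed.

Lemma ractZl a v X : A X -> M (a *: v) X = a *: M v X.
Proof.
by move=> AX; have := ract_linl M AX a v 0; rewrite (ract0l AX) !addr0.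
Qed.

Lemma ractDl u v X : A X -> M (u + v) X = M u X + M v X.
Proof. by move=> AX; have := ract_linl M AX 1 u v; rewrite !scale1r. Qed.

End Modules.

(** * Compatible maps on an extension *)

Section ExtensionGluing.
Variables (D : group_datum) (C : fieldType) (c : parameter D C) (H : hecke c).
Local Notation W1 := (gW1 D).
Local Notation T := (hT H).
Local Notation iota := (@giota D).
Variables (Xi Xi' : H -> C) (V V' : lmodType C).
Variables (M : rmodule (HXi2 Xi Xi') V) (N : rmodule (HXi2 Xi Xi') V').
Local Notation sub := (@Haff_sub_HXi2 _ _ _ H Xi Xi').
Local Notation P := (pre_stab2 Xi Xi').
Hypothesis M_Xi : forall v X, Haff X -> M v X = Xi X *: v.
Hypothesis N_Xi' : forall n X, Haff X -> N n X = Xi' X *: n.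
Variable E : extension (rrestr sub M) (rrestr sub N).
Local Notation i := (@ext_inj _ _ _ _ _ _ _ E).
Local Notation q := (@ext_proj _ _ _ _ _ _ _ E).

Lemma ext_injD a x y : i (a *: x + y) = a *: i x + i y.
Proof. by have [il _] := ext_inj_hom E; rewrite il. Qed.

Lemma ext_projD a x y : q (a *: x + y) = a *: q x + q y.
Proof. by have [ql _] := ext_proj_hom E; rewrite ql. Qed.

Lemma ext_inj_X n X : Haff X -> E (i n) X = i (N n X).
Proof. by have [_ iA] := ext_inj_hom E => HX; rewrite iA. Qed.

Lemma ext_proj_X e X : Haff X -> q (E e X) = M (q e) X.
Proof. by have [_ qA] := ext_proj_hom E => HX; rewrite qA. Qed.

Lemma ext_inj0 : i 0 = 0.
Proof. by have := ext_injD (-1) 0 0; rewrite !scaleN1r !addNr. Qed.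

Lemma ext_proj0 : q 0 = 0.
Proof. by have := ext_projD (-1) 0 0; rewrite !scaleN1r !addNr. Qed.

Lemma ext_projI n : q (i n) = 0.
Proof. by apply/ext_exact; exists n. Qed.

(** These are the conditions that the action of [T om] satisfies in any module over [HXi2] extending
    [E] and making its two maps [HXi2]-linear. *)
Definition T_compatible (om : W1) (f : ext_sort E -> ext_sort E) : Prop :=
  [/\ linear f,
      forall e X, Haff X -> E (f e) X = f (E e (T om * X * T om^-1%g)),
      forall n, f (i n) = i (N n (T om))
    & forall e, q (f e) = M (q e) (T om)].

(* The difference [h] of two compatible maps factors through a map [V -> V'], so
   that [H^aff] acts on its source through [Xi] and on its image through
   [Xi']. *)
Lemma factor_conj om (h : ext_sort E -> ext_sort E) e X :
  P om -> linear h -> (forall n, h (i n) = 0) ->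
  Haff X -> h (E e (T om * X * T om^-1%g)) = Xi X *: h e.
Proof.
move=> omP hl hi HX; set Y := _ * _ * _.
have HY : Haff Y by exact: Haff_conj omP.1 HX.
(* [E e Y - Xi Y *: e] projects to zero in [V], hence comes from [V'], where [h] vanishes. *)
have hY : h (E e Y) = Xi Y *: h e.
  have /ext_exact[n nE] : q (- Xi Y *: e + E e Y) = 0.
    by rewrite ext_projD ext_proj_X // M_Xi // scaleNr addNr.
  have := hi n; rewrite nE hl scaleNr => /eqP.
  by rewrite addrC subr_eq0 => /eqP.
rewrite hY; have [qe0|/eqP qe0] := eqVneq (q e) 0.
  by have /ext_exact[n <-] := qe0; rewrite hi !scaler0.
(* The equality [Xi Y = Xi X] is read off from the nonzero vector [v]: acting by [X] after [T om] is
   acting by [Y] before it. *)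
congr (_ *: _); have BT := HXi2_T omP; have BTV := HXi2_T (pre_stab2V omP).
set v := M (q e) (T om).
have v0 : v != 0.
  apply/eqP => v0; apply: qe0.
  have := ractM M (q e) BT BTV; rewrite -/v v0 (pre_stab2_TK omP) ract1 => <-.
  exact: ract0l.
have : Xi Y *: v = Xi X *: v.
  rewrite -(M_Xi v HX) /v ractM //; last exact: sub.
  rewrite -ractZl // -(M_Xi _ HY) ractM //; last exact: sub.
  by rewrite /Y -mulrA (pre_stab2_TVK omP) mulr1.
move/eqP; rewrite -subr_eq0 -scalerBl scaler_eq0 (negPf v0) orbF subr_eq0.
by move/eqP.
Qed.

Lemma T_compatibleB om f g : P om -> T_compatible om f -> T_compatible om g ->
  let h e := f e - g e in
  forall e X, Haff X -> E (h e) X = Xi' X *: h e /\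
    h (E e (T om * X * T om^-1%g)) = Xi X *: h e.
Proof.
move=> omP [fl fX fi fq] [gl gX gi gq] h e X HX; split.
  have /ext_exact[n <-] : q (h e) = 0.
    have := ext_projD (-1) (g e) (f e).
    by rewrite !scaleN1r addrC fq gq addNr.
  rewrite ext_inj_X // N_Xi' //.
  by have := ext_injD (Xi' X) n 0; rewrite !addr0 ext_inj0 addr0.
apply: factor_conj => // [a u v|n].
  by rewrite /h fl gl scalerBr opprD addrACA.
by rewrite /h fi gi subrr.
Qed.

Lemma T_compatibleM v w f g : P v -> P w ->
  T_compatible v f -> T_compatible w g -> T_compatible (v * w)%g (g \o f).
Proof.
move=> vP wP [fl fX fi fq] [gl gX gi gq].
have [Bv Bw] := (HXi2_T vP, HXi2_T wP).
split=> [a x y|e X HX|n|e] /=.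
- by rewrite fl gl.
- rewrite gX // fX; last exact: Haff_conj wP.1 HX.
  rewrite invMg (hT_Oml _ _ vP.1) (hT_Oml _ _ (waffV_Om wP.1)).
  by rewrite !mulrA.
- by rewrite fi gi ractM // hT_Oml //; exact: vP.1.
- by rewrite gq fq ractM // hT_Oml //; exact: vP.1.
Qed.

Lemma T_compatible_iota t : T_compatible (iota t) (fun e => E e (T (iota t))).
Proof.
have t1 : Om1 (iota t) by exact: iota_waff.
have Ht : Haff (T (iota t)) by apply: Haff_T; exact: iota_wom.
split=> [a x y|e X HX|n|e].
- exact: ract_linl.
- have HY : Haff (T (iota t) * X * T (iota t)^-1%g) by exact: Haff_conj.
  rewrite !ractM // -!mulrA -hT_Omr // mulVg hT1 mulr1 //.
- by rewrite ext_inj_X.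
- by rewrite ext_proj_X.
Qed.

(** [rmodule_glue] supplies the action on the middle term; on a product [X * T om] the maps [i] and
    [q] respect it by compatibility, and the restriction gives back [E] through the identity map. *)
Lemma extension_glue (th : W1 -> ext_sort E -> ext_sort E) :
  (forall om, P om -> T_compatible om (th om)) ->
  (forall v w e, P v -> P w -> th (v * w)%g e = th w (th v e)) ->
  (forall t e, th (iota t) e = E e (T (iota t))) ->
  exists F : extension M N, ext_equiv (ext_restr sub F) E.
Proof.
move=> thC thM thZ.
have thl om : P om -> linear (th om) by case/thC.
have thX om e X : P om -> Haff X ->
    E (th om e) X = th om (E e (T om * X * T om^-1%g)).
  by case/thC=> _ + _ _; exact.
have [R RE] := rmodule_glue thl thM thX thZ.
have RX e X : Haff X -> R e X = E e X.
  move=> HX; rewrite -[X in LHS]mulr1 -hT1 -giota1 RE //; last first.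
    exact: pre_stab2_iota.
  by rewrite thZ giota1 hT1 ract1.
have iB : rmod_hom N R i.
  split=> [a x y|n X]; first exact: ext_injD.
  move: X; apply: HXi2_ind => [X om HX omP|a X Y BX BY IX IY].
    have [_ _ thi _] := thC om omP.
    rewrite RE // ext_inj_X // thi ractM //; first exact: sub.
    exact: HXi2_T.
  by rewrite !ract_linr // ext_injD IX IY.
have qB : rmod_hom R M q.
  split=> [a x y|e X]; first exact: ext_projD.
  move: X; apply: HXi2_ind => [X om HX omP|a X Y BX BY IX IY].
    have [_ _ _ thq] := thC om omP.
    rewrite RE // thq ext_proj_X // ractM //; first exact: sub.
    exact: HXi2_T.
  by rewrite !ract_linr // ext_projD IX IY.
pose F := Extension iB qB (@ext_injI _ _ _ _ _ _ _ E)
  (@ext_projS _ _ _ _ _ _ _ E) (@ext_exact _ _ _ _ _ _ _ E).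
by exists F, id; split=> //; exact: inv_bij.
Qed.

(** * Invariant extensions, according to whether [Xi] and [Xi'] differ on [Haff] *)

Hypothesis E_inv : forall om (omP : P om),
  ext_equiv (ext_act (pre_stab2_unit omP) E) E.

(** An equivalence from the twist of [E] to [E] is such a map: the twisted action yields the
    conjugation, and the twisted end maps yield [T om] on [N] and [M]. *)
Lemma T_compatible_exists om : P om -> exists f, T_compatible om f.
Proof.
move=> omP; have [f [[fl fA] _ fi fq]] := E_inv omP.
have [BT BTV] := (HXi2_T omP, HXi2_T (pre_stab2V omP)).
exists f; split=> //.
- by move=> e X HX; rewrite -fA.
- move=> n; rewrite -[RHS]fi /=; congr (f (i _)).
  by rewrite ractM // (pre_stab2_TK omP) ract1.
Qed.

(** Uniqueness is used twice, for maps compatible with one element: [th (v * w)] against the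
    composite of [th v] and [th w], and [th (iota t)] against the action of [T (iota t)]. *)
Lemma extension_glue_neq X0 : Haff X0 -> Xi X0 <> Xi' X0 ->
  exists F : extension M N, ext_equiv (ext_restr sub F) E.
Proof.
move=> HX0 neq.
have uniq om f g : P om -> T_compatible om f -> T_compatible om g -> f =1 g.
  move=> omP fC gC e; apply/subr0_eq.
  have [e1 e2] := T_compatibleB omP fC gC e HX0.
  have [_ fX _ _] := fC; have [_ gX _ _] := gC.
  (* The difference intertwines the action of [T om * X0 * T om^-1] on its source, through [Xi X0],
     with that of [X0] on its values, through [Xi' X0]. *)
  have : (Xi X0 - Xi' X0) *: (f e - g e) = 0.
    rewrite scalerBl -e1 -e2; apply/eqP; rewrite subr_eq0; apply/eqP.
    rewrite -fX // -gX // [f e - g e]addrC -[- g e]scaleN1r (ract_linl E HX0).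
    by rewrite scaleN1r addrC.
  by move/eqP; rewrite scaler_eq0 subr_eq0 => /orP[/eqP|/eqP].
have /choice[th thC] : forall om, exists f, P om -> T_compatible om f.
  move=> om; have [omP|nP] := pselect (P om); last by exists id.
  by have [f fC] := T_compatible_exists omP; exists f.
apply: (extension_glue thC) => [v w e vP wP|t e].
  have vwP := pre_stab2M vP wP.
  exact: uniq vwP (thC _ vwP) (T_compatibleM vP wP (thC _ vP) (thC _ wP)) e.
have tP := pre_stab2_iota Xi Xi' t.
exact: uniq tP (thC _ tP) (T_compatible_iota t) e.
Qed.

(* With [sg v T_t = a sg v + d], induction gives
   [sg v T_(t^k) = a^k sg v + k a^(k-1) d]; take [k] the order of [Z_kappa]. *)
Lemma section_iota (sg : V -> ext_sort E) v t :
  #|gZ D|%:R != 0 :> C -> (forall X, Haff X -> Xi X = Xi' X) ->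
  sg 0 = 0 -> q (sg v) = v ->
  E (sg v) (T (iota t)) = Xi (T (iota t)) *: sg v.
Proof.
move=> n0 XiE sg0 qsg; set a := Xi _.
have Ht u : Haff (T (iota u)) by apply: Haff_T; exact: iota_wom.
(* For nonzero [v], the action of [t] on [v] will give [a ^+ n = 1], with [n] the order of
   [gZ D]. *)
have [v0|v0] := eqVneq v 0.
  by rewrite v0 sg0 scaler0 (ract0l _ (Ht t)).
pose d := E (sg v) (T (iota t)) - a *: sg v.
have dt : E d (T (iota t)) = a *: d.
  have /ext_exact[m <-] : q d = 0.
    rewrite /d addrC -scaleNr ext_projD ext_proj_X // M_Xi // qsg.
    by rewrite scaleNr addNr.
  rewrite ext_inj_X // N_Xi' // -XiE //.
  by have := ext_injD a m 0; rewrite !addr0 ext_inj0 addr0.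
have TX k : T (iota (t ^+ k.+1)%g) = T (iota (t ^+ k)%g) * T (iota t).
  by rewrite expgSr gmulfM hT_Oml //; exact: iota_waff.
(* The formula is multiplied by [a], so that the exponent [k - 1] does not occur. *)
have Ek k : a *: E (sg v) (T (iota (t ^+ k)%g)) =
    a ^+ k.+1 *: sg v + (k%:R * a ^+ k) *: d.
  elim: k => [|k IH].
    by rewrite expg0 giota1 hT1 ract1 mul0r scale0r addr0 expr1.
  rewrite TX -ractM // -ractZl // IH ractDl // !ractZl // dt.
  rewrite -[E (sg v) _](subrK (a *: sg v)) -/d scalerDr scalerA -exprSr.
  rewrite addrAC addrC scalerA -scalerDl; congr (_ + _ *: _).
  by rewrite -mulrA -exprSr mulrS mulrDl mul1r.
have Mk k : M v (T (iota (t ^+ k)%g)) = a ^+ k *: v.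
  elim: k => [|k IH]; first by rewrite expg0 giota1 hT1 ract1 expr0 scale1r.
  rewrite TX -ractM; try exact: sub.
  by rewrite IH M_Xi // scalerA exprS.
have tn : (t ^+ #|gZ D|)%g = 1%g by rewrite -cardsT expg_cardG ?inE.
have an : a ^+ #|gZ D| = 1.
  have := Mk #|gZ D|; rewrite tn giota1 hT1 ract1 => /esym/eqP.
  rewrite -subr_eq0 -{2}[v]scale1r -scalerBl scaler_eq0 (negPf v0) orbF subr_eq0.
  by move/eqP.
(* At the order of [gZ D] the terms in [sg v] cancel and [#|gZ D|%:R *: d = 0] remains. *)
have := Ek #|gZ D|; rewrite tn giota1 hT1 ract1 exprS an mulr1 => /eqP.
rewrite -{1}[a *: _]addr0 (inj_eq (addrI _)) mulr1 eq_sym scaler_eq0 (negPf n0) /=.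
by rewrite subr_eq0 => /eqP.
Qed.

(** A linear section [sg] of [q] splits [E] as a vector space, and [th om] acts by [T om] on each
    summand, so multiplicativity comes from the module laws of [N] and [M]. Only compatibility with
    [Haff] calls for the invariance of [E]. *)
Lemma extension_glue_eq (I : choiceType) (e : I -> V) : is_basis e ->
  #|gZ D|%:R != 0 :> C -> (forall X, Haff X -> Xi X = Xi' X) ->
  exists F : extension M N, ext_equiv (ext_restr sub F) E.
Proof.
move=> eB n0 XiE.
have [s sP] := choice (fun j => ext_projS E (e j)).
have [sg sgE] := basis_extend eB s.
have qsg v : q (sg v) = v.
  move: v (eB.2 v); apply: lspan_ind.
  - by rewrite linear0 ext_proj0.
  - by move=> _ [j _ <-]; rewrite sgE.
  - by move=> a u v _ _ IU IV; rewrite linearP ext_projD IU IV.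
have /choice[r rP] : forall x, exists n, i n = x - sg (q x).
  move=> x; apply/ext_exact; have := ext_projD (-1) (sg (q x)) x.
  by rewrite !scaleN1r addrC qsg addNr.
have split_i n v : r (i n + sg v) = n.
  apply: (@ext_injI _ _ _ _ _ _ _ E); rewrite rP.
  have := ext_projD 1 (i n) (sg v); rewrite !scale1r ext_projI add0r qsg => ->.
  by rewrite addrK.
have split_q n v : q (i n + sg v) = v.
  by have := ext_projD 1 (i n) (sg v); rewrite !scale1r ext_projI add0r qsg.
have splitE x : x = i (r x) + sg (q x) by rewrite rP subrK.
have rl : linear r.
  move=> a x y; apply: (@ext_injI _ _ _ _ _ _ _ E).
  rewrite ext_injD !rP ext_projD linearP scalerBr opprD addrACA.
  by congr (_ + _); rewrite addrC.
pose th om x := i (N (r x) (T om)) + sg (M (q x) (T om)).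
have thi om n : P om -> th om (i n) = i (N n (T om)).
  move=> omP; rewrite /th ext_projI (ract0l _ (HXi2_T omP)) linear0 addr0.
  by have := split_i n 0; rewrite linear0 addr0 => ->.
have thl om : P om -> linear (th om).
  move=> /HXi2_T BT a x y; rewrite /th rl ext_projD !(ract_linl _ BT).
  by rewrite ext_injD linearP scalerDr addrACA.
have thC om : P om -> T_compatible om (th om).
  move=> omP; split.
  - exact: thl.
  (* Write [th om = f - h] with [f] compatible. The difference [h] kills [i] and takes values in its
     image, so [Xi = Xi'] gives [h] the same conjugation rule as [f]. *)
  - have [f [fl fX fi fq]] := T_compatible_exists omP.
    move=> x X HX; pose h y := f y - th om y.
    have hE y : th om y = f y - h y by rewrite /h subKr.
    have hl : linear h.
      by move=> a u v; rewrite /h fl thl // scalerBr opprD addrACA.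
    have hi n : h (i n) = 0 by rewrite /h fi thi // subrr.
    have hq : q (h x) = 0.
      have := ext_projD (-1) (th om x) (f x).
      by rewrite !scaleN1r addrC fq /th split_q addNr.
    rewrite !hE (factor_conj _ omP hl hi HX) addrC -scaleN1r.
    rewrite (ract_linl E HX) fX // scaleN1r addrC; congr (_ - _).
    have /ext_exact[n <-] := hq.
    rewrite ext_inj_X // N_Xi' // XiE //.
    by have := ext_injD (Xi' X) n 0; rewrite !addr0 ext_inj0 addr0.
  - by move=> n; exact: thi.
  - by move=> x; rewrite /th split_q.
apply: (extension_glue thC) => [v w x vP wP|t x].
  rewrite -[RHS]/(i (N (r (th v x)) (T w)) + sg (M (q (th v x)) (T w))).
  rewrite [r _]split_i [q _]split_q.
  have [Bv Bw] := (HXi2_T vP, HXi2_T wP).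
  by rewrite !ractM // -hT_Oml //; exact: vP.1.
have Ht : Haff (T (iota t)) by apply: Haff_T; exact: iota_wom.
(* By [section_iota], [T (iota t)] preserves the splitting and so acts as [th (iota t)]. *)
rewrite [in RHS](splitE x) ractDl // ext_inj_X //.
by rewrite section_iota ?linear0 // /th M_Xi // linearZ.
Qed.

End ExtensionGluing.

(** * Surjectivity onto the invariant classes *)

Unset Implicit Arguments.
Set Strict Implicit.

Theorem theorem4p5
    (C : closedFieldType) (p : nat) (pC : p \in [pchar C])
    (D : group_datum) (Zp : coprime p #|gZ D|)
    (c : parameter D C) (H : hecke c)
    (chi chi' : gZ D -> C) (chiP : is_charZ chi) (chi'P : is_charZ chi')
    (J J' : set (gWaff D))
    (JP : J `<=` Saff_chi c chi) (J'P : J' `<=` Saff_chi c chi')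
    (Xi Xi' : H -> C) (XiP : is_Xi J chi Xi) (Xi'P : is_Xi J' chi' Xi')
    (V V' : lmodType C)
    (rV : rmodule (COm Xi) V) (rV' : rmodule (COm Xi') V')
    (simpleV : rmod_simple rV) (simpleV' : rmod_simple rV')
    (chiV : isotypicZ chi rV) (chiV' : isotypicZ chi' rV')
    (M : rmodule (HXi Xi) V) (M' : rmodule (HXi Xi') V')
    (MP : is_Xi_tensor rV M) (M'P : is_Xi_tensor rV' M') :
  let M2 := rrestr (HXi2_subl (Xi := Xi) (Xi' := Xi')) M in
  let M2' := rrestr (HXi2_subr (Xi := Xi) (Xi' := Xi')) M' in
  forall y : Ext1_aff_inv M2 M2', exists x : Ext1 M2 M2', Ext1_res_inv x = y.
Proof.
move=> M2 M2' [y yinv]; have [E yE] := Ext1_ofP y.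
have E_inv om (omP : pre_stab2 Xi Xi' om) :
    ext_equiv (ext_act (pre_stab2_unit omP) E) E.
  have := yinv om omP; rewrite yE Ext1_act_of.
  (* Equal classes are equal predicates; evaluating both at [E] turns invariance of the class into
     an equivalence of extensions. *)
  move=> /(congr1 (fun x => sval x E)) /= EE.
  change (ext_class (ext_act (pre_stab2_unit omP) E) E); rewrite EE.
  exact: ext_equiv_refl.
have n0 : #|gZ D|%:R != 0 :> C.
  have p_pr : prime p := pcharf_prime pC.
  by rewrite -(dvdn_pcharf pC) -prime_coprime.
have MX v X (HX : Haff X) : M2 v X = Xi X *: v := Xi_tensor_Haff v MP HX.
have MX' v X (HX : Haff X) : M2' v X = Xi' X *: v := Xi_tensor_Haff v M'P HX.
have [F FE] : exists F : extension M2 M2',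
    ext_equiv (ext_restr (@Haff_sub_HXi2 _ _ _ H Xi Xi') F) E.
  have [[X0 [HX0 neq]]|XiE] := pselect (exists X, Haff X /\ Xi X <> Xi' X).
    exact (extension_glue_neq MX MX' E_inv HX0 neq).
  (* The basis of [V] on which the linear section is defined. *)
  have [I [e [eB _]]] := chiV.
  apply: (extension_glue_eq MX MX' E_inv eB n0) => X HX.
  by apply: contrapT => neq; apply: XiE; exists X.
exists (Ext1_of F); apply: eq_exist.
by rewrite Ext1_restr_of yE; exact: Ext1_of_eq.
Qed.
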